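(* Let $R$ be a reduced commutative ring with unity. Then $\operatorname{clique}\Gamma(R) = \operatorname{clique}\Gamma(R[X]) = \operatorname{clique}\Gamma(R[\![X]\!])$ and $\chi(\Gamma(R)) = \chi(\Gamma(R[X])) = \chi(\Gamma(R[\![X]\!]))$.
   Context: For a commutative ring $A$, $\Gamma(A)$ denotes its zero-divisor graph: the simple graph whose vertices are the nonzero zero-divisors of $A$, two distinct vertices $a,b$ being adjacent precisely when $ab=0$. Here $R[X]$ and $R[\![X]\!]$ are the polynomial ring and the power series ring in one indeterminate $X$ over $R$. For a graph $G$: $\operatorname{clique} G$ is the supremum of the cardinalities of sets of vertices on which the induced subgraph is complete; $\chi(G)$ is the infimum of the cardinalities of sets $A$ for which there is a map from the vertices of $G$ to $A$ taking different values on adjacent vertices. *)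

(* Defs.v *)
From HB Require Import structures.
From mathcomp Require Import all_boot all_order all_algebra.
From mathcomp Require Import boolp classical_sets functions cardinality.

Set Implicit Arguments.
Unset Strict Implicit.
Unset Printing Implicit Defensive.
Import GRing.Theory.
Local Open Scope classical_set_scope.
Local Open Scope ring_scope.
Local Open Scope card_scope.

(* A record rather than a synonym of nat -> R, so that the product below does
   not compete with the pointwise product of functions. *)
Record powerseries (R : Type) := PowerSeries { coefps : nat -> R }.

Notation "{ 'powerseries' R }" := (powerseries R)
  (format "{ 'powerseries'  R }") : type_scope.

HB.instance Definition _ (R : Type) := gen_eqMixin {powerseries R}.
HB.instance Definition _ (R : Type) := gen_choiceMixin {powerseries R}.

Section PowerSeriesRing.
Variable R : comNzRingType.
Implicit Types f g h : {powerseries R}.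

Lemma powerseriesP f g : (forall n, coefps f n = coefps g n) -> f = g.
Proof. by case: f g => [f] [g] /= /funext ->. Qed.

Definition ps0 : {powerseries R} := PowerSeries (fun=> 0).
Definition ps1 : {powerseries R} := PowerSeries (fun n => (n == 0%N)%:R).
Definition psopp f := PowerSeries (fun n => - coefps f n).
Definition psadd f g := PowerSeries (fun n => coefps f n + coefps g n).
Definition psmul f g :=
  PowerSeries (fun n => \sum_(i < n.+1) coefps f i * coefps g (n - i)%N).

Fact psaddA : associative psadd.
Proof. by move=> f g h; apply: powerseriesP => n /=; rewrite addrA. Qed.
Fact psaddC : commutative psadd.
Proof. by move=> f g; apply: powerseriesP => n /=; rewrite addrC. Qed.
Fact psadd0 : left_id ps0 psadd.
Proof. by move=> f; apply: powerseriesP => n /=; rewrite add0r. Qed.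
Fact psaddN : left_inverse ps0 psopp psadd.
Proof. by move=> f; apply: powerseriesP => n /=; rewrite addNr. Qed.

HB.instance Definition _ :=
  GRing.isZmodule.Build {powerseries R} psaddA psaddC psadd0 psaddN.

Let trunc N f : {poly R} := \poly_(i < N) coefps f i.

Let coef_psmul N f g n : (n < N)%N ->
  coefps (psmul f g) n = (trunc N f * trunc N g)`_n.
Proof.
move=> nN; rewrite coefM; apply: eq_bigr => i _; rewrite !coef_poly.
by rewrite (leq_ltn_trans (leq_ord i) nN) (leq_ltn_trans (leq_subr i n) nN).
Qed.

Fact psmulC : commutative psmul.
Proof.
by move=> f g; apply: powerseriesP => n; rewrite !(@coef_psmul n.+1) // mulrC.
Qed.

Fact psmulA : associative psmul.
Proof.
move=> f g h; apply: powerseriesP => n.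
have sub f1 g1 h1 : coefps (psmul f1 (psmul g1 h1)) n =
    (trunc n.+1 f1 * (trunc n.+1 g1 * trunc n.+1 h1))`_n.
  rewrite coefM /=; apply: eq_bigr => i _.
  rewrite coef_poly ltn_ord; congr (_ * _).
  by rewrite -coef_psmul // ltnS leq_subr.
by rewrite (psmulC (psmul f g)) !sub mulrA mulrC.
Qed.

Fact psmul1 : left_id ps1 psmul.
Proof.
move=> f; apply: powerseriesP => n /=.
by rewrite big_ord_recl /= mul1r subn0 big1 ?addr0 // => i _; rewrite mul0r.
Qed.

Fact psmulDl : left_distributive psmul psadd.
Proof.
move=> f g h; apply: powerseriesP => n /=; rewrite -big_split /=.
by apply: eq_bigr => i _; rewrite mulrDl.
Qed.

Fact ps1_neq0 : ps1 != 0.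
Proof.
by apply/eqP => /(congr1 (fun f => coefps f 0%N)) /= /eqP; rewrite oner_eq0.
Qed.

HB.instance Definition _ := GRing.Zmodule_isComNzRing.Build {powerseries R}
  psmulA psmulC psmul1 psmulDl ps1_neq0.

End PowerSeriesRing.

Definition reduced (A : comPzRingType) : Prop :=
  forall (x : A) (n : nat), x ^+ n = 0 -> x = 0.

Record simple_graph := SimpleGraph {
  vertex : Type;
  adj : vertex -> vertex -> Prop;
  adj_sym : forall a b, adj a b -> adj b a;
  adj_irrefl : forall a, ~ adj a a }.

Section ZeroDivisorGraph.
Variable A : comPzRingType.

Definition zero_divisor (a : A) : Prop := exists2 b : A, b <> 0 & a * b = 0.

Definition zdg_vertices : set A := [set a | a <> 0 /\ zero_divisor a].

Definition zdg_adj (a b : zdg_vertices) : Prop :=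
  a <> b /\ \val a * \val b = 0.

Fact zdg_adj_sym a b : zdg_adj a b -> zdg_adj b a.
Proof. by move=> [ab ab0]; split; [exact: nesym | rewrite mulrC]. Qed.

Fact zdg_adj_irrefl a : ~ zdg_adj a a.
Proof. by case. Qed.

Definition zero_divisor_graph : simple_graph :=
  SimpleGraph zdg_adj_sym zdg_adj_irrefl.

End ZeroDivisorGraph.

Definition is_clique (G : simple_graph) (C : set (vertex G)) : Prop :=
  forall a b, C a -> C b -> a <> b -> adj a b.

Definition is_coloring (G : simple_graph) (K : Type) (c : vertex G -> K) :
  Prop := forall a b, adj a b -> c a <> c b.

Definition colorable (G : simple_graph) (K : Type) : Prop :=
  exists c : vertex G -> K, is_coloring c.

(* A possibly infinite cardinal is represented by any type having that
   cardinality, and cardinals are compared with #<=.  The next two predicates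
   say that the cardinality of K is the supremum, resp. the infimum, of a class
   of cardinals; they determine K up to #=. *)
Definition is_clique_number (G : simple_graph) (K : Type) : Prop :=
  (forall C : set (vertex G), is_clique C -> C #<= [set: K]) /\
  (forall L : Type, (forall C : set (vertex G), is_clique C -> C #<= [set: L]) ->
     [set: K] #<= [set: L]).

Definition is_chromatic_number (G : simple_graph) (K : Type) : Prop :=
  (forall L : Type, colorable G L -> [set: K] #<= [set: L]) /\
  (forall M : Type, (forall L : Type, colorable G L -> [set: M] #<= [set: L]) ->
     [set: M] #<= [set: K]).

(* Main.v *)
Require Import Defs.
From mathcomp Require Import all_boot all_order all_algebra.
From mathcomp Require Import boolp classical_sets functions cardinality.

Set Implicit Arguments.
Unset Strict Implicit.
Unset Printing Implicit Defensive.
Import GRing.Theory.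
Local Open Scope classical_set_scope.
Local Open Scope ring_scope.
Local Open Scope card_scope.

(** The three graphs admit homomorphisms
      Gamma(R) -> Gamma(R[X]) -> Gamma(R[[X]]) -> Gamma(R),
    and a homomorphism G -> H bounds both invariants of G by those of H: it is
    injective on cliques, since adjacent vertices are distinct and have adjacent,
    hence distinct, images; and it pulls colorings of H back to G.  Going around
    the cycle, the three graphs have the same bounds on cliques and the same
    colorings.

    The first two homomorphisms are the inclusions of rings.  The last one sends
    a power series to one of its nonzero coefficients.  It respects adjacency
    because a reduced ring has the Armendariz property for power series:
    f g = 0 forces f_i g_j = 0 for all i and j ([powerseries_mul0_coef]).  Two
    coefficients obtained in this way from adjacent series are automatically
    distinct, as an element whose square is 0 vanishes ([zdg_homomorphic]).

    It remains to see that the supremum and the infimum of cardinals that define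
    the two invariants exist.  Only cardinals up to that of the vertex set
    matter, and these are realized by its subsets; so this follows from the fact
    that any nonempty family of sets has a member of least cardinality
    ([card_min_family]), a consequence of Zorn's lemma. *)

(** * Comparing cardinals *)

Lemma card_le_injP (T U : Type) (A : set T) (B : set U) :
  A #<= B <-> exists f : A -> B, injective f.
Proof.
split=> [/card_leP[f]|[f injf]].
  by exists f => x y /(@inj _ _ _ f); apply; rewrite in_setT.
have /injPex[g] : exists g : A -> B, set_inj [set: A] g.
  by exists f => x y _ _; exact: injf.
by apply/card_leP; squash ('totalfun_[set: A] g).
Qed.

Lemma card_leTT_injP (T U : Type) :
  [set: T] #<= [set: U] <-> exists f : T -> U, injective f.
Proof.
rewrite card_le_injP; split=> -[f injf].
  exists (fun x => val (f (to_setT x))) => x y /val_inj/injf.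
  by move/(congr1 val).
by exists (to_setT \o f \o val) => x y /(congr1 val)/= /injf/val_inj.
Qed.

Lemma card_set_type (T : Type) (A : set T) : A #= [set: A].
Proof.
apply: Cantor_Bernstein; apply/card_le_injP.
  by exists to_setT => x y /(congr1 val).
by exists val; exact: val_inj.
Qed.

(** Hoenig's argument: among the sets E of choice functions on which every
    evaluation at an index is injective, take a maximal one.  Some evaluation
    maps E onto its factor X i, as otherwise a function avoiding all the images
    could be added to E; then X i is in bijection with E, which every evaluation
    injects into the corresponding X j. *)
Lemma card_min_family (I : Type) (X : I -> Type) : inhabited I ->
  exists i, forall j, [set: X i] #<= [set: X j].
Proof.
move=> [i0].
pose P (E : set (forall i, X i)) :=
  forall i x y, E x -> E y -> x i = y i -> x = y.
have [F FP Ftot|E [PE maxE]] := @Zorn_bigcup _ P.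
  move=> i x y [A FA Ax] [B FB By].
  by have [AB|BA] := Ftot _ _ FA FB;
    [exact: (FP _ FB i _ _ (AB _ Ax) By) | exact: (FP _ FA i _ _ Ax (BA _ By))].
have [i surj_i] : exists i, forall t : X i, exists2 x, E x & x i = t.
  apply: contrapT => /forallNP nosurj.
  pose y i := projT1 (cid ((existsNP _).2 (nosurj i))).
  have yE i x : E x -> x i <> y i.
    by move=> Ex xy; apply: (projT2 (cid ((existsNP _).2 (nosurj i)))); exists x.
  apply: (maxE (E `|` [set y])).
    split=> [x|sub]; first by left.
    have Ey : E y by apply: sub; right.
    exact: yE i0 y Ey erefl.
  move=> i x z [Ex|->] [Ez|->] //.
  - exact: PE.
  - by move=> /(yE i x Ex).
  - by move=> /esym/(yE i z Ez).
have /choice[g gE] : forall t : X i, exists x, E x /\ x i = t.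
  by move=> t; have [x Ex xt] := surj_i t; exists x.
exists i => j; apply/card_leTT_injP; exists (fun t => g t j) => s t gst.
by rewrite -(gE s).2 -(gE t).2 (PE _ _ _ (gE s).1 (gE t).1 gst).
Qed.

Lemma card_le_total (T U : Type) :
  [set: T] #<= [set: U] \/ [set: U] #<= [set: T].
Proof.
have [[] min] := @card_min_family bool (fun b => if b then T else U) (inhabits true).
  by left; exact: (min false).
by right; exact: (min true).
Qed.

Lemma card_min_subset (V : Type) (P : set (set V)) : P !=set0 ->
  exists2 S, P S & forall S', P S' -> S #<= S'.
Proof.
move=> [S0 PS0].
have [[S PS] min] :=
  @card_min_family {S : set V | P S} (fun S => sval S) (inhabits (exist _ S0 PS0)).
exists S => // S' PS'; have := min (exist _ S' PS') => /= SS'.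
rewrite (card_le_eql (card_set_type S)) (card_le_eqr (card_set_type S')).
exact: SS'.
Qed.

(** * Existence of clique numbers and chromatic numbers *)

Definition clique_bound (G : simple_graph) (L : Type) : Prop :=
  forall C : set (vertex G), is_clique C -> C #<= [set: L].

(** The supremum is the least cardinality of a set S of vertices into which all
    cliques inject.  An arbitrary upper bound L is compared with the whole vertex
    set: if L is smaller, it is equipotent to such an S. *)
Lemma clique_number_exists (G : simple_graph) :
  exists K : Type, is_clique_number G K.
Proof.
have [|S Sbound minS] := @card_min_subset (vertex G)
    [set S | forall C : set (vertex G), is_clique C -> C #<= S].
  by exists [set: vertex G] => C _; exact: card_leT.
exists S; split=> [C /Sbound|L Lbound].
  by rewrite (card_le_eqr (card_set_type S)).
rewrite -(card_le_eql (card_set_type S)).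
have [VL|] := card_le_total (vertex G) L.
  exact: card_le_trans (card_leT S) VL.
move=> /card_leTT_injP[f injf].
have rangef : range f #= [set: L] by apply: inj_card_eq => x y _ _; exact: injf.
rewrite -(card_le_eqr rangef); apply: minS => C /Lbound.
by rewrite (card_le_eqr rangef).
Qed.

(** The infimum is attained by the smallest set of vertices that can serve as a
    set of colors: replacing each color that occurs by a vertex of that color
    turns any coloring into one by vertices. *)
Lemma chromatic_number_exists (G : simple_graph) :
  exists K : Type, is_chromatic_number G K.
Proof.
have [|S colS minS] := @card_min_subset (vertex G) [set S : set (vertex G) | colorable G S].
  exists [set: vertex G], to_setT => a b ab /(congr1 val)/= eab.
  by rewrite eab in ab; exact: adj_irrefl ab.
exists S; split=> [L [c col]|M Mmin]; last exact: Mmin.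
rewrite -(card_le_eql (card_set_type S)).
(* r picks a representative of every color class. *)
have /choice[r rP] : forall l : range c, exists a, c a = val l.
  by move=> l; have [a _ cal] := set_mem (valP l); exists a.
have injr : injective r.
  by move=> l m rlm; apply: val_inj; rewrite -!rP rlm.
have le_rL : range r #<= [set: L].
  apply: card_le_trans (card_image_le _ _) _.
  by rewrite -(card_le_eql (card_set_type _)); exact: card_leT.
apply: card_le_trans le_rL; apply: minS.
have cl a : c a \in range c by apply/mem_set; exists a.
have rl a : r (SigSub (cl a)) \in range r by apply/mem_set; exists (SigSub (cl a)).
exists (fun a => SigSub (rl a)) => a b ab /(congr1 val)/= /injr/(congr1 val)/=.
exact: col.
Qed.

(** * Graph homomorphisms *)

Definition homomorphic (G H : simple_graph) : Prop :=
  exists phi : vertex G -> vertex H,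
    forall a b, adj a b -> adj (phi a) (phi b).

Lemma homomorphic_trans (G H K : simple_graph) :
  homomorphic G H -> homomorphic H K -> homomorphic G K.
Proof.
by move=> [phi Hphi] [psi Hpsi]; exists (psi \o phi) => a b /Hphi/Hpsi.
Qed.

Lemma homomorphic_clique_bound (G H : simple_graph) (L : Type) :
  homomorphic G H -> clique_bound H L -> clique_bound G L.
Proof.
move=> [phi Hphi] HL C clC.
have injphi : {in C &, injective phi}.
  move=> a b /set_mem Ca /set_mem Cb eab; apply: contrapT => /(clC _ _ Ca Cb).
  by move=> /Hphi; rewrite eab; exact: adj_irrefl.
rewrite -(card_le_eql (inj_card_eq injphi)); apply: HL.
move=> _ _ [a Ca <-] [b Cb <-] nab; apply/Hphi/clC => // eab.
by apply: nab; rewrite eab.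
Qed.

Lemma homomorphic_colorable (G H : simple_graph) (L : Type) :
  homomorphic G H -> colorable H L -> colorable G L.
Proof. by move=> [phi Hphi] [c Hc]; exists (c \o phi) => a b /Hphi/Hc. Qed.

Lemma homomorphic_clique_number (G H : simple_graph) (K : Type) :
  homomorphic G H -> homomorphic H G ->
  is_clique_number G K -> is_clique_number H K.
Proof.
move=> GH HG [ub least]; split=> [|L HL].
  exact: homomorphic_clique_bound HG ub.
by apply: least; exact: homomorphic_clique_bound GH HL.
Qed.

Lemma homomorphic_chromatic_number (G H : simple_graph) (K : Type) :
  homomorphic G H -> homomorphic H G ->
  is_chromatic_number G K -> is_chromatic_number H K.
Proof.
move=> GH HG [lb greatest]; split=> [L HL|M Mlb].
  by apply: lb; exact: homomorphic_colorable GH HL.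
by apply: greatest => L GL; apply: Mlb; exact: homomorphic_colorable HG GL.
Qed.

(** Only zero products matter, so phi need not be additive or multiplicative;
    this is what allows a choice of coefficient as a homomorphism.  Adjacent a
    and b cannot be identified: phi a would have square 0. *)
Lemma zdg_homomorphic (A B : comPzRingType) (phi : A -> B) :
  (forall b : B, b * b = 0 -> b = 0) ->
  (forall a, a <> 0 -> phi a <> 0) ->
  (forall a b, a * b = 0 -> phi a * phi b = 0) ->
  homomorphic (zero_divisor_graph A) (zero_divisor_graph B).
Proof.
move=> redB phi_neq0 phi_mul0.
have phiV (a : @zdg_vertices A) : phi (val a) \in @zdg_vertices B.
  have [a0 [b b0 ab0]] := set_mem (valP a).
  apply/mem_set; split; first exact: phi_neq0.
  by exists (phi b); [exact: phi_neq0 | exact: phi_mul0].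
exists (fun a => SigSub (phiV a)) => a b [_ ab0].
have phiab0 := phi_mul0 _ _ ab0; split=> //= /(congr1 val)/= eab.
have [a0 _] := set_mem (valP a); apply: (phi_neq0 _ a0); apply: redB.
by rewrite {2}eab.
Qed.

(** * Zero products of power series *)

Section ReducedCoefficients.
Variable R : comNzRingType.
Hypothesis hR : reduced R.

Lemma reduced_sqr0 (x : R) : x * x = 0 -> x = 0.
Proof. by rewrite -expr2; exact: hR. Qed.

(** Induction on i + j.  Multiply the equation (f g)_(i + j) = 0 by f_i g_j: for
    k <> i, one of the products f_k g_j and f_i g_(i + j - k) has smaller total
    index and is 0, so that only (f_i g_j)^2 = 0 remains. *)
Lemma powerseries_mul0_coef (f g : {powerseries R}) :
  f * g = 0 -> forall i j, coefps f i * coefps g j = 0.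
Proof.
move=> fg0 i j; have [n] := ubnP (i + j)%N; elim: n => // n IH in i j *.
rewrite ltnS => le_ij_n; apply: reduced_sqr0.
have := congr1 (fun h => coefps h (i + j) * (coefps f i * coefps g j)) fg0.
have lt_i : (i < (i + j).+1)%N by rewrite ltnS leq_addr.
rewrite /= mul0r (bigD1 (Ordinal lt_i)) //= addKn mulrDl mulr_suml.
rewrite big1 ?addr0 // => k /eqP k_neq_i.
rewrite [coefps f i * _]mulrC mulrACA.
have [lt_ki|lt_ik|eq_ki] := ltngtP k i; last by case: k_neq_i; exact: val_inj.
  by rewrite (IH k j) ?mul0r // (leq_trans _ le_ij_n) // ltn_add2r.
rewrite [coefps g _ * _]mulrC (IH i (i + j - k)%N) ?mulr0 //.
have k_le : (k <= i + j)%N by rewrite -ltnS.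
by rewrite (leq_trans _ le_ij_n) // ltn_add2l ltn_subLR // ltn_add2r.
Qed.

Lemma powerseries_sqr0 (f : {powerseries R}) : f * f = 0 -> f = 0.
Proof.
by move=> ff0; apply: powerseriesP => n; apply/reduced_sqr0/powerseries_mul0_coef.
Qed.

Definition poly_series (p : {poly R}) : {powerseries R} :=
  PowerSeries (fun n => p`_n).

Lemma poly_series_inj : injective poly_series.
Proof.
by move=> p q pq; apply/polyP => n; exact: (congr1 (fun f => coefps f n) pq).
Qed.

Lemma poly_series0 : poly_series 0 = 0.
Proof. by apply: powerseriesP => n /=; rewrite coef0. Qed.

Lemma poly_seriesM p q : poly_series (p * q) = poly_series p * poly_series q.
Proof. by apply: powerseriesP => n /=; rewrite coefM. Qed.

Lemma poly_sqr0 (p : {poly R}) : p * p = 0 -> p = 0.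
Proof.
move=> pp0; apply/poly_series_inj; rewrite poly_series0; apply/powerseries_sqr0.
by rewrite -poly_seriesM pp0 poly_series0.
Qed.

Lemma homomorphic_ring_poly :
  homomorphic (zero_divisor_graph R) (zero_divisor_graph {poly R}).
Proof.
apply: (@zdg_homomorphic R {poly R} polyC) => [|a a0|a b ab0].
- exact: poly_sqr0.
- by move/eqP; rewrite polyC_eq0 => /eqP.
- by rewrite -polyCM ab0.
Qed.

Lemma homomorphic_poly_powerseries :
  homomorphic (zero_divisor_graph {poly R}) (zero_divisor_graph {powerseries R}).
Proof.
apply: (@zdg_homomorphic {poly R} {powerseries R} poly_series) => [|p p0|p q pq0].
- exact: powerseries_sqr0.
- by rewrite -poly_series0 => /poly_series_inj.
- by rewrite -poly_seriesM pq0 poly_series0.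
Qed.

Lemma homomorphic_powerseries_ring :
  homomorphic (zero_divisor_graph {powerseries R}) (zero_divisor_graph R).
Proof.
have /choice[idx idxP] (f : {powerseries R}) :
    exists n, f <> 0 -> coefps f n <> 0.
  have [->|f0] := pselect (f = 0); first by exists 0%N.
  have [n fn] : exists n, coefps f n <> 0.
    by apply/existsNP => f_eq0; apply: f0; exact: powerseriesP.
  by exists n.
apply: (@zdg_homomorphic {powerseries R} R (fun f => coefps f (idx f))).
- exact: reduced_sqr0.
- exact: idxP.
- by move=> f g fg0; exact: powerseries_mul0_coef.
Qed.

End ReducedCoefficients.

Theorem proposition4p3 (R : comNzRingType) (hR : reduced R) :
  (exists kappa : Type,
     is_clique_number (zero_divisor_graph R) kappa /\
     is_clique_number (zero_divisor_graph {poly R}) kappa /\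
     is_clique_number (zero_divisor_graph {powerseries R}) kappa) /\
  (exists kappa : Type,
     is_chromatic_number (zero_divisor_graph R) kappa /\
     is_chromatic_number (zero_divisor_graph {poly R}) kappa /\
     is_chromatic_number (zero_divisor_graph {powerseries R}) kappa).
Proof.
have RP := homomorphic_ring_poly hR.
have PS := homomorphic_poly_powerseries hR.
have SR := homomorphic_powerseries_ring hR.
have RS := homomorphic_trans RP PS; have PR := homomorphic_trans PS SR.
split.
  have [K RK] := clique_number_exists (zero_divisor_graph R).
  by exists K; split=> //; split;
    [exact: homomorphic_clique_number RP PR RK
    | exact: homomorphic_clique_number RS SR RK].
have [K RK] := chromatic_number_exists (zero_divisor_graph R).
by exists K; split=> //; split;
  [exact: homomorphic_chromatic_number RP PR RK
  | exact: homomorphic_chromatic_number RS SR RK].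
Qed.
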